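(* Let $G$ be a finite simple connected graph that contains no induced subgraph isomorphic to $P_5$, to $C_5$, or to $K_{2,3}$. Then $G$ is perfectly divisible.
   Context: $P_t$ and $C_t$ denote the path and cycle on $t$ vertices, and $K_{p,q}$ the complete bipartite graph with parts of sizes $p,q$. $\omega(H)$ is the clique number of $H$. A graph is perfect if every induced subgraph $H$ satisfies $\chi(H)=\omega(H)$. A graph $H$ admits a perfect division $(A,B)$ if $V(H)$ can be partitioned into $A$ and $B$ such that $H[A]$ is perfect and $\omega(H[B])<\omega(H)$. A graph $G$ is perfectly divisible if every induced subgraph of $G$ admits a perfect division. *)

(* Defs.v *)
From mathcomp Require Import all_boot.

Set Implicit Arguments.
Unset Strict Implicit.
Unset Printing Implicit Defensive.

Record sgraph := SGraph {
  vertex :> finType;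
  adj : rel vertex;
  adj_sym : symmetric adj;
  adj_irrefl : irreflexive adj
}.

Section Induced.
Variables (G : sgraph) (S : {set G}).

Definition induced_adj : rel {x : G | x \in S} := relpre val (@adj G).

Lemma induced_adj_sym : symmetric induced_adj.
Proof. by move=> x y; apply: adj_sym. Qed.

Lemma induced_adj_irrefl : irreflexive induced_adj.
Proof. by move=> x; apply: adj_irrefl. Qed.

Definition induced : sgraph := SGraph induced_adj_sym induced_adj_irrefl.

End Induced.

Definition contains_induced (G H : sgraph) : Prop :=
  exists2 f : H -> G, injective f & forall x y, adj (f x) (f y) = adj x y.

Definition connected_graph (G : sgraph) : Prop :=
  0 < #|G| /\ forall x y : G, connect (@adj G) x y.

Section Path.
Variable t : nat.

Definition path_adj : rel 'I_t := fun i j => (i.+1 == j) || (j.+1 == i).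

Lemma path_adj_sym : symmetric path_adj.
Proof. by move=> i j; rewrite /path_adj orbC. Qed.

Lemma path_adj_irrefl : irreflexive path_adj.
Proof. by move=> i; rewrite /path_adj orbb eqn_leq ltnn. Qed.

Definition path_graph : sgraph := SGraph path_adj_sym path_adj_irrefl.

End Path.

Section Cycle.
Variable t : nat.

(* The conjunct [i != j] only matters for [t = 1], where it removes a loop. *)
Definition cycle_adj : rel 'I_t :=
  fun i j => (i != j) && ((i.+1 %% t == j) || (j.+1 %% t == i)).

Lemma cycle_adj_sym : symmetric cycle_adj.
Proof. by move=> i j; rewrite /cycle_adj eq_sym orbC. Qed.

Lemma cycle_adj_irrefl : irreflexive cycle_adj.
Proof. by move=> i; rewrite /cycle_adj eqxx. Qed.

Definition cycle_graph : sgraph := SGraph cycle_adj_sym cycle_adj_irrefl.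

End Cycle.

Section CompleteBipartite.
Variables p q : nat.

Definition bipartite_adj : rel ('I_p + 'I_q)%type := fun u v =>
  match u, v with
  | inl _, inr _ | inr _, inl _ => true
  | _, _ => false
  end.

Lemma bipartite_adj_sym : symmetric bipartite_adj.
Proof. by case=> i []. Qed.

Lemma bipartite_adj_irrefl : irreflexive bipartite_adj.
Proof. by case. Qed.

Definition complete_bipartite : sgraph :=
  SGraph bipartite_adj_sym bipartite_adj_irrefl.

End CompleteBipartite.

Definition clique (G : sgraph) (K : {set G}) : bool :=
  [forall x in K, forall y in K, (x != y) ==> adj x y].

Definition omega (G : sgraph) : nat := \max_(K : {set G} | clique K) #|K|.

Definition colorable (G : sgraph) (k : nat) : bool :=
  [exists c : {ffun G -> 'I_k}, [forall x, forall y, adj x y ==> (c x != c y)]].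

Lemma colorable_ex (G : sgraph) : exists k, colorable G k.
Proof.
exists #|G|; apply/existsP; exists [ffun x => enum_rank x].
apply/forallP => x; apply/forallP => y; apply/implyP.
by apply: contraTN; rewrite !ffunE => /eqP/enum_rank_inj->; rewrite adj_irrefl.
Qed.

Definition chi (G : sgraph) : nat := ex_minn (colorable_ex G).

Definition perfect (G : sgraph) : Prop :=
  forall S : {set G}, chi (induced S) = omega (induced S).

(* One of the two parts may be empty. *)
Definition perfect_division (H : sgraph) (A B : {set H}) : Prop :=
  [/\ A :|: B = [set: H], [disjoint A & B],
      perfect (induced A) & omega (induced B) < omega H].

(* The graph without vertices has [omega = 0], hence no perfect division:     *)
(* induced subgraphs are taken on nonempty vertex sets.                       *)
Definition perfectly_divisible (G : sgraph) : Prop :=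
  forall S : {set G}, S != set0 ->
    exists A B : {set induced S}, perfect_division A B.

(* Main.v *)
Require Import Defs.
From mathcomp Require Import all_boot.

Set Implicit Arguments.
Unset Strict Implicit.
Unset Printing Implicit Defensive.

(** If some vertex [v] has a perfect set of non-neighbours, then the non-neighbours
    of [v] (with [v]) and the neighbours of [v] form a perfect division.

    Otherwise choose a minimal imperfect set [F] and a connected set [Z]
    anticomplete to it with [#|Z|] maximum, and let [X] be the set of vertices
    outside [Z] with a neighbour in [Z].  By maximality every [x] in [X] has a
    neighbour in [F]; excluding P5, C5 and K_{2,3} then makes [X] a clique.  The
    non-neighbours of [x] contain a minimal imperfect set [F'], which must meet
    [Z] (else [x |: Z] and [F'] contradict maximality), so [x] is mixed on [Z]; by
    P5-freeness it is complete to the component [R] of [G - (Z :|: X)] containing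
    [F].  Thus [R] is attached to the rest of the graph by a clique complete to
    it, and perfect divisions of [R] and of its complement can be united. *)

(** * Cliques and the clique number of vertex sets *)

Lemma cliqueP (G : sgraph) (K : {set G}) :
  reflect {in K &, forall x y, x != y -> adj x y} (clique K).
Proof.
apply: (iffP 'forall_in_'forall_in_implyP) => h x; first by move=> y xK yK; apply: h.
by move=> xK y yK; apply: h.
Qed.

Lemma clique_sub (G : sgraph) (K L : {set G}) :
  K \subset L -> clique L -> clique K.
Proof.
move=> /subsetP KL /cliqueP cL; apply/cliqueP => x y /KL xL /KL yL.
exact: cL.
Qed.

Section Subsets.

Variable G : sgraph.
Implicit Types (x y v : G) (A B C D F K P Q R S T W X Z : {set G}).

Definition nbhd x : {set G} := [set y | adj x y].

(** The clique number of the subgraph induced by [S], taken over sets of [G] itself so that no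
    subtypes arise; [omega_imset] ties it to [omega]. *)
Definition om S := \max_(K : {set G} | clique K && (K \subset S)) #|K|.

Lemma om_max K S : clique K -> K \subset S -> #|K| <= om S.
Proof. by move=> cK KS; apply: (leq_bigmax_cond (P := fun K => _)); rewrite cK. Qed.

Lemma clique0 : clique (set0 : {set G}).
Proof. by apply/cliqueP => x y; rewrite inE. Qed.

Lemma om_witness S : exists K, [/\ clique K, K \subset S & #|K| = om S].
Proof.
have : 0 < #|[pred K : {set G} | clique K && (K \subset S)]|.
  by apply/card_gt0P; exists set0; rewrite inE clique0 sub0set.
case/(eq_bigmax_cond (fun K : {set G} => #|K|)) => K; rewrite inE => /andP[cK KS] e.
by exists K; split=> //; rewrite /om -e.
Qed.

Lemma om_sub S T : S \subset T -> om S <= om T.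
Proof.
move=> ST; have [K [cK KS <-]] := om_witness S.
by apply: om_max => //; apply: subset_trans ST.
Qed.

Definition complete A B := {in A & B, forall x y, adj x y}.

(** A maximum clique of [D] together with [Y] is again a clique. The two are disjoint because a
    common vertex would be adjacent to itself. *)
Lemma om_join D Y :
  clique Y -> complete D Y -> om D + #|Y| <= om (D :|: Y).
Proof.
move=> cY cDY; have [K [cK /subsetP KD <-]] := om_witness D.
have dKY : [disjoint K & Y].
  apply/pred0P => x /=; apply/andP => -[/KD xD xY].
  by have := cDY _ _ xD xY; rewrite adj_irrefl.
have -> : #|K| + #|Y| = #|K :|: Y| by rewrite cardsU disjoint_setI0 // cards0 subn0.
apply: om_max; last by apply: setSU; apply/subsetP.
apply/cliqueP => x y; rewrite !inE.
case/orP=> [xK|xY] /orP[yK|yY] xy.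
- by move/cliqueP: cK; apply.
- by apply: cDY => //; apply: KD.
- by rewrite adj_sym; apply: cDY => //; apply: KD.
- by move/cliqueP: cY; apply.
Qed.

Definition proper_coloring S k (c : G -> nat) :=
  {in S, forall x, c x < k} /\ {in S &, forall x y, adj x y -> c x <> c y}.

(** Boolean, so that [minset] can select minimal imperfect sets and the existence of a vertex with
    perfect non-neighbourhood can be decided. *)
Definition perf S : bool :=
  [forall T : {set G}, (T \subset S) ==> (chi (induced T) == omega (induced T))].

End Subsets.

(** * Clique number and colourings along an induced embedding *)

Section Embedding.

Variables (G H : sgraph) (f : H -> G).
Hypotheses (f_inj : injective f) (f_adj : forall x y, adj (f x) (f y) = adj x y).

Lemma clique_imset (K : {set H}) : clique (f @: K) = clique K.
Proof.
apply/cliqueP/cliqueP => cK x y.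
  move=> xK yK xy; rewrite -f_adj; apply: cK; rewrite ?imset_f //.
  by rewrite inj_eq.
case/imsetP=> x' xK -> /imsetP[y' yK ->]; rewrite inj_eq // f_adj.
exact: cK.
Qed.

Lemma omega_imset : omega H = om (f @: [set: H]).
Proof.
apply/eqP; rewrite eqn_leq; apply/andP; split.
  apply/bigmax_leqP => K cK; rewrite -(card_imset (mem K) f_inj).
  by apply: om_max; [rewrite clique_imset | apply/imsetS/subsetT].
apply/bigmax_leqP => K /andP[cK KS].
have eK : K = f @: (f @^-1: K).
  apply/setP => y; apply/idP/imsetP => [yK | [x + ->]]; last by rewrite inE.
  have /imsetP[x _ e] := subsetP KS _ yK.
  by exists x; rewrite // inE -e.
rewrite eK card_imset //.
apply: (leq_bigmax_cond (P := @clique H)).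
by rewrite -clique_imset -eK.
Qed.

Lemma colorable_imset k :
  colorable H k <-> exists c, proper_coloring (f @: [set: H]) k c.
Proof.
split.
  case/existsP=> c /'forall_'forall_implyP cP.
  pose g (y : G) := [pick x | f x == y].
  have gf x : g (f x) = Some x.
    by rewrite /g; case: pickP => [z /eqP/f_inj-> // | /(_ x)]; rewrite eqxx.
  (* [g] is a partial inverse of [f]; the colour 0 outside the image of [f] is a dummy. *)
  exists (fun y => if g y is Some x then c x : nat else 0); split.
    by move=> _ /imsetP[x _ ->]; rewrite gf.
  move=> _ _ /imsetP[x _ ->] /imsetP[y _ ->]; rewrite !gf f_adj => xy.
  by move=> e; have /eqP := cP _ _ xy; apply; apply: val_inj.
case=> c [ck cP]; apply/existsP.
have ck' x : c (f x) < k by apply: ck; rewrite imset_f.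
exists [ffun x => Ordinal (ck' x)]; apply/'forall_'forall_implyP => x y xy.
rewrite !ffunE -val_eqE /=; apply/eqP; apply: cP; rewrite ?imset_f ?f_adj //.
Qed.

(** A proper colouring is injective on every clique, so [chi] is never below [omega]; equality
    therefore amounts to having a colouring with [omega] colours. *)
Lemma chi_omega_imset :
  chi H = omega H <->
  exists c, proper_coloring (f @: [set: H]) (om (f @: [set: H])) c.
Proof.
rewrite -omega_imset /chi; case: ex_minnP => m cm m_min.
split=> [<- | /colorable_imset co]; first exact/colorable_imset.
apply/eqP; rewrite eqn_leq m_min //=.
apply/bigmax_leqP => K /cliqueP cK; move: cm => /existsP[c /'forall_'forall_implyP cP].
rewrite -[m]card_ord; have c_inj : {in K &, injective c}.
  move=> x y xK yK e; apply/eqP/idPn => xy.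
  by have := cP _ _ (cK _ _ xK yK xy); rewrite e eqxx.
by rewrite -(card_in_imset c_inj) max_card.
Qed.

End Embedding.

(** * Perfect vertex sets and gluing along a clique *)

Section Perfect.

Variable G : sgraph.
Implicit Types (x y v : G) (A B C D F K P Q R S T W X Z : {set G}).

Lemma val_imsetT T : [set val x | x in [set: induced T]] = T.
Proof.
apply/setP => x; apply/imsetP/idP => [[y _ ->] | xT]; first exact: (valP y).
by exists (exist _ x xT : induced T).
Qed.

Lemma perfP S :
  reflect (forall T, T \subset S -> exists c, proper_coloring T (om T) c) (perf S).
Proof.
have e T : chi (induced T) = omega (induced T) <-> exists c, proper_coloring T (om T) c.
  have := @chi_omega_imset G (induced T) val val_inj (fun _ _ => erefl).
  by rewrite val_imsetT.
apply: (iffP 'forall_implyP) => h T TS; first by apply/e/eqP/h.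
by apply/eqP/e/h.
Qed.

Lemma perf_clique K : clique K -> perf K.
Proof.
move=> cK; apply/perfP => T TK; have cT := clique_sub TK cK.
exists (fun x => index x (enum T)); split=> [x xT | x y xT yT xy].
  by apply: leq_trans (om_max cT (subxx _)); rewrite cardE index_mem mem_enum.
move=> e; have exy : x = y.
  by rewrite -[x](nth_index x (s := enum T)) ?mem_enum // e nth_index ?mem_enum.
by rewrite exy adj_irrefl in xy.
Qed.

Lemma free_colors n (s : seq nat) :
  n - size s <= size [seq i <- iota 0 n | i \notin s].
Proof.
have := count_predC (mem s) (iota 0 n); rewrite size_iota => e.
rewrite size_filter leq_subLR -[X in X <= _]e leq_add2r -size_filter.
apply: uniq_leq_size; first by rewrite filter_uniq ?iota_uniq.
by move=> i; rewrite mem_filter => /andP[].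
Qed.

(* The colours missing from the clique [X] suffice for [D]. *)
Lemma perf_glue D W X :
  clique X -> complete D X ->
  {in D & W, forall x y, adj x y -> y \in X} ->
  perf D -> perf W -> perf (D :|: W).
Proof.
move=> cX cDX DWX /perfP pD /perfP pW; apply/perfP => T TDW.
have [c1 [c1k c1P]] := pD _ (subsetIr T D).
have [c2 [c2k c2P]] := pW _ (subsetIr T W).
set Y := X :&: (T :&: W).
have YX : Y \subset X by apply: subsetIl.
have cY := clique_sub YX cX.
have omT : om (T :&: D) + #|Y| <= om T.
  apply: leq_trans (om_join cY _) _.
    by move=> x y; rewrite !inE => /andP[_ xD] /andP[yX _]; apply: cDX.
  by apply: om_sub; apply/subsetP => x; rewrite !inE => /orP[] => [|/andP[_]] /andP[].
(* [L] lists the colours below [om T] that [c2] does not use on [Y]. A vertex [x] of [D] will get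
   entry number [c1 x] of [L], the others keep [c2]; [c1L] ensures that the default of [nth] is
   never reached. *)
set s := [seq c2 y | y <- enum Y].
set L := [seq i <- iota 0 (om T) | i \notin s].
have sL : om (T :&: D) <= size L.
  apply: leq_trans (free_colors _ _); rewrite size_map -cardE.
  by rewrite -(addnK #|Y| (om _)) leq_sub2r.
have c1L x : x \in T :&: D -> c1 x < size L by move/c1k/leq_trans; apply.
have LP x : x \in T :&: D -> nth 0 L (c1 x) < om T /\ nth 0 L (c1 x) \notin s.
  move/c1L/(mem_nth 0); rewrite mem_filter mem_iota /= => /andP[-> ?].
  by split.
have TW x : x \in T -> x \notin D -> x \in T :&: W.
  move=> xT xD; have := subsetP TDW _ xT; rewrite !inE (negbTE xD) xT /=.
  by [].
have cross x y : x \in T :&: D -> y \in T -> y \notin D -> adj x y ->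
    nth 0 L (c1 x) <> c2 y.
  move=> xD yT yD xy e; have [_] := LP _ xD; rewrite e => /negP; apply.
  have yW := TW _ yT yD; apply: map_f; rewrite mem_enum inE yW andbT.
  by move: xD yW; rewrite !inE => /andP[_ xD] /andP[_ yW]; apply: DWX xy.
exists (fun x => if x \in D then nth 0 L (c1 x) else c2 x); split.
  move=> x xT; case: ifPn => xD.
    by have [] := LP x; rewrite ?inE ?xT.
  apply: leq_trans (c2k _ (TW _ xT xD)) (om_sub _); apply: subsetIl.
move=> x y xT yT xy.
case: ifPn => xD; case: ifPn => yD.
- have xTD : x \in T :&: D by rewrite inE xT.
  have yTD : y \in T :&: D by rewrite inE yT.
  move/eqP; rewrite nth_uniq ?c1L // ?filter_uniq ?iota_uniq //.
  by move/eqP; apply: c1P.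
- by apply: cross; rewrite // inE xT.
- by move/esym; apply: cross; rewrite 1?adj_sym // inE yT.
- by apply: c2P => //; apply: TW.
Qed.

(** * Connected vertex sets *)

(** Connectedness by cuts: an edge leaves every nonempty proper part of [C]. The empty set counts as
    connected. *)
Definition conn C :=
  [forall P : {set G}, [&& P \subset C, P != set0 & P != C] ==>
    [exists x in P, exists y in C :\: P, adj x y]].

Lemma connP C :
  reflect (forall P, P \subset C -> P != set0 -> P != C ->
             exists x y, [/\ x \in P, y \in C, y \notin P & adj x y])
          (conn C).
Proof.
apply: (iffP 'forall_implyP) => h P.
  move=> PC P0 PneC; have /exists_inP[x xP /exists_inP[y]] :
      [exists x in P, exists y in C :\: P, adj x y] by apply: h; apply/and3P.
  by rewrite inE => /andP[yP yC] xy; exists x, y.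
case/and3P=> PC P0 PneC; have [x [y [xP yC yP xy]]] := h P PC P0 PneC.
by apply/exists_inP; exists x => //; apply/exists_inP; exists y; rewrite ?inE ?yP.
Qed.

Lemma conn1 x : conn [set x].
Proof.
apply/connP => P; rewrite subset1 => /orP[] /eqP->; by rewrite eqxx.
Qed.

Lemma conn_add C x y : conn C -> y \in C -> adj x y -> conn (x |: C).
Proof.
move=> /connP cC yC xy; have [xC|xC] := boolP (x \in C).
  by rewrite (setUidPr _) ?sub1set //; apply/connP.
apply/connP => P PC P0 PneC.
have [CP | CnP] := boolP (C \subset P).
  have xP : x \notin P.
    by apply: contra PneC => xP; rewrite eqEsubset PC subUset sub1set xP CP.
  by exists y, x; rewrite adj_sym xy (subsetP CP) // !inE eqxx.
have [PC0|PC0] := eqVneq (P :&: C) set0.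
  have xP : x \in P.
    case/set0Pn: P0 => z zP; have := subsetP PC _ zP; rewrite !inE.
    case/orP=> [/eqP<- //|zC].
    by have : z \in P :&: C; [rewrite inE zP | rewrite PC0 inE].
  exists x, y; rewrite !inE yC orbT; split=> //.
  by apply/negP => yP; have : y \in P :&: C; [rewrite inE yP | rewrite PC0 inE].
have [|a [b []]] := cC (P :&: C) (subsetIr _ _) PC0.
  by apply: contra CnP => /eqP<-; apply: subsetIl.
rewrite !inE => /andP[aP aC] bC; rewrite bC andbT => bP ab.
by exists a, b; rewrite !inE bC orbT.
Qed.

(** An edge must cross the cut of [C] into neighbours and non-neighbours of [x]. Such edges are the
    ends of the induced paths P5 built below. *)
Lemma conn_mixed C x :
  conn C -> (exists2 y, y \in C & adj x y) -> (exists2 y, y \in C & ~~ adj x y) ->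
  exists y z, [/\ y \in C, z \in C, adj x y, ~~ adj x z & adj y z].
Proof.
move=> /connP cC [y yC xy] [z zC xz].
have [|||a [b []]] := cC (C :&: nbhd x).
- exact: subsetIl.
- by apply/set0Pn; exists y; rewrite !inE yC.
- by apply: contra xz => /eqP e; move: zC; rewrite -{1}e !inE => /andP[].
by rewrite !inE => /andP[aC xa] bC; rewrite bC /= => xb ab; exists a, b.
Qed.

Lemma component_exists C S : conn C -> C \subset S ->
  exists R, [/\ conn R, C \subset R, R \subset S &
                {in R & S, forall x y, adj x y -> y \in R}].
Proof.
move=> cC CS.
have [|R] := @maxset_exists G (fun R => conn R && (R \subset S)) C; first exact/andP.
case/maxsetP=> /andP[cR RS] Rmax CR; exists R; split=> // x y xR yS xy.
suff <- : y |: R = R by rewrite !inE eqxx.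
apply: Rmax; last exact: subsetUr.
by rewrite (conn_add cR xR) ?subUset ?sub1set ?yS // adj_sym.
Qed.

(** * Minimal imperfect sets *)

Definition min_imperf F := minset (fun F => ~~ perf F) F.

Lemma min_imperfP F : min_imperf F ->
  ~~ perf F /\ (forall T, T \proper F -> perf T).
Proof.
case/minsetP=> iF Fmin; split=> // T; rewrite properEneq => /andP[TF sTF].
by apply: contraNT TF => iT; rewrite (Fmin T).
Qed.

Lemma min_imperf_exists S : ~~ perf S -> exists2 F, min_imperf F & F \subset S.
Proof.
by move=> iS; have [F mF FS] := @minset_exists G (fun F => ~~ perf F) S iS; exists F.
Qed.

(** Both [D] and [F :\: D] are proper subsets of [F], hence perfect, and [perf_glue] would make [F]
    perfect. *)
Lemma min_imperf_noglue F D X : min_imperf F ->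
  D \subset F -> D != set0 -> D != F -> clique X -> complete D X ->
  {in D & F, forall x y, adj x y -> (y \in D) || (y \in X)} -> False.
Proof.
case/min_imperfP=> iF Fmin DF D0 DneF cX cDX DFX.
move/negP: iF; apply.
have -> : F = D :|: (F :\: D) by rewrite -{1}(setID F D) (setIidPr DF).
apply: (perf_glue cX cDX).
- move=> x y xD; rewrite inE => /andP[yD yF] xy.
  by have := DFX _ _ xD yF xy; rewrite (negbTE yD).
- by apply: Fmin; rewrite properEneq DneF.
- apply: Fmin; rewrite properEneq subsetDl andbT.
  apply: contra D0 => /eqP e; apply/eqP/setP => x; rewrite inE; apply/negP => xD.
  by have := subsetP DF _ xD; rewrite -e inE xD.
Qed.

(** A part that no edge leaves could be glued to the rest along the empty clique. *)
Lemma min_imperf_conn F : min_imperf F -> conn F.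
Proof.
move=> mF; apply/connP => P PF P0 PneF.
have [/exists_inP[x xP /exists_inP[y]]|] :=
    boolP [exists x in P, exists y in F :\: P, adj x y].
  by rewrite inE => /andP[yP yF] xy; exists x, y.
move/exists_inPn => h; exfalso.
apply: (min_imperf_noglue mF PF P0 PneF (clique0 G)) => [x y _|x y xP yF xy].
  by rewrite inE.
have /exists_inPn h' := h x xP; apply/orP; left; apply/idPn => yP.
by have := h' y; rewrite inE yP yF xy => /(_ isT).
Qed.

Lemma min_imperf_neq0 F : min_imperf F -> F != set0.
Proof.
case/min_imperfP=> iF _; apply: contraNneq iF => ->.
exact/perf_clique/clique0.
Qed.

(** * Attachments between anticomplete sets when P5, C5 and K_{2,3} are excluded *)

Section Free.

Hypothesis P5_free : forall a b c d e : G,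
  adj a b -> adj b c -> adj c d -> adj d e ->
  ~~ adj a c -> ~~ adj a d -> ~~ adj a e -> ~~ adj b d -> ~~ adj b e -> ~~ adj c e ->
  False.
Hypothesis C5_free : forall a b c d e : G,
  adj a b -> adj b c -> adj c d -> adj d e -> adj e a ->
  ~~ adj a c -> ~~ adj a d -> ~~ adj b d -> ~~ adj b e -> ~~ adj c e ->
  False.
Hypothesis K23_free : forall a b x y z : G,
  a != b -> ~~ adj a b -> x != y -> x != z -> y != z ->
  ~~ adj x y -> ~~ adj x z -> ~~ adj y z ->
  adj a x -> adj a y -> adj a z -> adj b x -> adj b y -> adj b z -> False.

Definition anticomplete A B := [forall x in A, forall y in B, ~~ adj x y].

Lemma anticompleteP A B :
  reflect {in A & B, forall x y, ~~ adj x y} (anticomplete A B).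
Proof.
apply: (iffP 'forall_in_forall_inP) => h x; first by move=> y xA yB; apply: h.
by move=> xA y yB; apply: h.
Qed.

(* Otherwise [F] splits along that clique: by P5-freeness (path [z - x - F])
   each vertex of [F] adjacent to [x] is complete or anticomplete to each
   component of the rest of [F]. *)
Lemma min_imperf_nbhd_not_clique F z x : min_imperf F ->
  {in F, forall f, ~~ adj z f} -> adj z x -> (exists2 f, f \in F & adj x f) ->
  clique (F :&: nbhd x) -> False.
Proof.
move=> mF zF zx [f0 f0F xf0] cQ.
have [d dF xd] : exists2 d, d \in F & ~~ adj x d.
  have [FQ|/subsetPn[d dF]] := boolP (F \subset nbhd x); last by rewrite inE; exists d.
  have [/negP[]] := min_imperfP mF; apply: perf_clique.
  by move: cQ; rewrite (setIidPl FQ).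
have [|D [cD dD DFQ Dcl]] := @component_exists [set d] (F :\: nbhd x) (conn1 d).
  by rewrite sub1set !inE xd.
move: dD; rewrite sub1set => dD.
have DP e : e \in D -> e \in F /\ ~~ adj x e.
  by move/(subsetP DFQ); rewrite !inE => /andP[].
pose X := [set y in F :&: nbhd x | [exists e in D, adj y e]].
apply: (@min_imperf_noglue F D X mF).
- by apply/subsetP => e /DP[].
- by apply/set0Pn; exists d.
- by apply: contraTneq xf0 => e; have [|_ ->] := DP f0; rewrite ?e.
- by apply: clique_sub cQ; apply/subsetP => y; rewrite inE => /andP[].
- move=> e y eD; rewrite !inE => /andP[/andP[yF xy] /exists_inP[e' e'D ye']].
  apply/idPn; rewrite adj_sym => ye.
  have [||a [b [aD bD ya yb ab]]] := @conn_mixed D y cD; [by exists e'|by exists e|].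
  have [[aF xa] [bF xb]] := (DP _ aD, DP _ bD).
  by apply: (@P5_free z x y a b); rewrite ?zF.
- move=> e y eD yF ey; have [xy|xy] := boolP (adj x y).
    apply/orP; right; rewrite !inE yF xy /=; apply/exists_inP; exists e => //.
    by rewrite adj_sym.
  by apply/orP; left; apply: Dcl ey; rewrite // !inE xy.
Qed.

Definition separated F Z :=
  [&& min_imperf F, conn Z, Z != set0, [disjoint Z & F] & anticomplete Z F].

Section Separated.

Variables F Z : {set G}.
Hypothesis sepFZ : separated F Z.

Let mF : min_imperf F. Proof. by case/and5P: sepFZ. Qed.
Let cZ : conn Z. Proof. by case/and5P: sepFZ. Qed.
Let aZF z f : z \in Z -> f \in F -> ~~ adj z f.
Proof. by case/and5P: sepFZ => _ _ _ _ /anticompleteP; apply. Qed.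

(** Two non-adjacent neighbours [f], [g] of [x1] in [F] would give a K_{2,3} with sides [x1], [x2]
    and [z], [f], [g]. So the neighbours of [x1] in [F] form a clique, against
    [min_imperf_nbhd_not_clique]. *)
Lemma nbhd_not_nested x1 x2 z :
  z \in Z -> adj z x1 -> adj z x2 -> x1 != x2 -> ~~ adj x1 x2 ->
  (exists2 f, f \in F & adj x1 f) -> {in F, forall f, adj x1 f -> adj x2 f} -> False.
Proof.
move=> zZ zx1 zx2 x12 nx12 h1 h12.
apply: (min_imperf_nbhd_not_clique mF _ zx1 h1) => [f|]; first exact: aZF.
apply/cliqueP => f g; rewrite !inE => /andP[fF xf] /andP[gF xg] fg.
have zne h : h \in F -> z != h.
  move=> hF; case/and5P: sepFZ => _ _ _ dZF _.
  by apply: contraTneq hF => <-; rewrite (disjointFr dZF).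
apply/idPn => nfg.
apply: (@K23_free x1 x2 z f g); rewrite ?zne ?(h12 f) ?(h12 g) //;
  first [by apply: aZF | by rewrite adj_sym].
Qed.

(** If [x] were mixed on both sides, an edge of [Z] and an edge of [F], each with exactly one end
    adjacent to [x], would form a P5 with [x] in the middle. *)
Lemma mixed_complete x :
  (exists2 z, z \in Z & adj x z) -> (exists2 z, z \in Z & ~~ adj x z) ->
  (exists2 f, f \in F & adj x f) -> {in F, forall f, adj x f}.
Proof.
move=> h1 h2 h3 f fF; apply/idPn => xf.
have [z [z' [zZ z'Z xz xz' zz']]] := conn_mixed cZ h1 h2.
have [|g [g' [gF g'F xg xg' gg']]] := conn_mixed (min_imperf_conn mF) h3.
  by exists f.
by apply: (@P5_free z' z x g g') => //; first [by apply: aZF | by rewrite adj_sym].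
Qed.

Lemma attachments_adj x1 x2 : x1 != x2 ->
  (exists2 z, z \in Z & adj x1 z) -> (exists2 z, z \in Z & adj x2 z) ->
  (exists2 f, f \in F & adj x1 f) -> (exists2 f, f \in F & adj x2 f) ->
  adj x1 x2.
Proof.
move=> x12 h1 h2 hF1 hF2; apply/idPn => nx12.
have nx21 : ~~ adj x2 x1 by rewrite adj_sym.
have [/exists_inP[z zZ /andP[x1z x2z]]|/exists_inPn ncommon] :=
    boolP [exists z in Z, adj x1 z && adj x2 z].
  have [zx1 zx2] : adj z x1 /\ adj z x2 by rewrite ![adj z _]adj_sym.
  have [/forall_inP/= h|/forall_inPn[f1 f1F]] :=
      boolP [forall f in F, adj x1 f ==> adj x2 f].
    by apply: (nbhd_not_nested zZ zx1 zx2 x12 nx12 hF1) => f fF; apply/implyP/h.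
  rewrite negb_imply => /andP[x1f1 x2f1].
  have [/forall_inP/= h|/forall_inPn[f2 f2F]] :=
      boolP [forall f in F, adj x2 f ==> adj x1 f].
    apply: (nbhd_not_nested zZ zx2 zx1 _ nx21 hF2); first by rewrite eq_sym.
    by move=> f fF; apply/implyP/h.
  rewrite negb_imply => /andP[x2f2 x1f2].
  (* With a common neighbour [z], the neighbourhoods in [F] are incomparable, so [f1] and [f2] are
     private to [x1] and [x2]. They close a C5 through [z] if adjacent, and end a P5 otherwise. *)
  have [f12|f12] := boolP (adj f1 f2).
    by apply: (@C5_free z x1 f1 f2 x2) => //; first [by apply: aZF | by rewrite adj_sym].
  by apply: (@P5_free f1 x1 z x2 f2) => //;
    first [by apply: aZF | by rewrite adj_sym | by rewrite adj_sym; apply: aZF].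
(* Without a common neighbour in [Z], both vertices are mixed on [Z], hence complete to [F], and any
   [f] in [F] joins them. *)
have nc z : z \in Z -> adj x1 z -> ~~ adj x2 z.
  by move=> zZ xz; have := ncommon z zZ; rewrite xz.
have n1 : exists2 z, z \in Z & ~~ adj x1 z.
  by have [z zZ xz] := h2; exists z => //; apply: contraL xz; apply: nc.
have n2 : exists2 z, z \in Z & ~~ adj x2 z.
  by have [z zZ xz] := h1; exists z => //; apply: nc.
have C1 := mixed_complete h1 n1 hF1; have C2 := mixed_complete h2 n2 hF2.
have [f fF _] := hF1.
have [a [b [aZ bZ x1a x1b ab]]] := conn_mixed cZ h1 n1.
(* Here [a] is adjacent to [x1] only. If [b] is adjacent to [x2], the cycle [x1 a b x2 f] is a C5;
   otherwise [b a x1 f x2] is a P5. *)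
have [x2b|x2b] := boolP (adj x2 b).
  apply: (@C5_free x1 a b x2 f); try solve [done | exact: aZF | by rewrite adj_sym].
  - exact: C2.
  - by rewrite adj_sym C1.
  - by rewrite adj_sym nc.
apply: (@P5_free b a x1 f x2); try solve [done | exact: aZF | by rewrite adj_sym].
- exact: C1.
- by rewrite adj_sym C2.
- by rewrite adj_sym nc.
Qed.

End Separated.

(** * Perfect divisions of vertex sets *)

Definition divisible S := exists A B,
  [/\ A :|: B = S, [disjoint A & B], perf A & om B < om S].

Lemma om_nbhd S v : v \in S -> om (S :&: nbhd v) < om S.
Proof.
move=> vS; have := @om_join G (S :&: nbhd v) [set v]; rewrite cards1 addn1.
move=> /(_ _ _)/leq_trans; apply.
- by apply/cliqueP => x y /set1P-> /set1P->; rewrite eqxx.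
- by move=> x y; rewrite !inE => /andP[_ vx] /eqP->; rewrite adj_sym.
- by apply: om_sub; rewrite subUset subsetIl sub1set.
Qed.

Lemma divisible_nonneighbors S v : v \in S -> perf (S :\: nbhd v) -> divisible S.
Proof.
move=> vS pv; exists (S :\: nbhd v), (S :&: nbhd v); split=> //.
- by rewrite setUC setID.
- by rewrite -setI_eq0; apply/eqP/setP => x; rewrite !inE; case: adj; rewrite ?andbF.
- exact: om_nbhd.
Qed.

(** The perfect parts glue along [X]. A maximum clique [K] of [B1 :|: B2] that misses [B1] lies in
    [B2], so it is smaller than [om W]. If it meets [B1], its remainder lies in [X], and trading
    [K :&: B1] for a maximum clique of [R] gives a strictly larger clique. *)
Lemma divisible_glue R W X :
  [disjoint R & W] -> X \subset W -> clique X -> complete R X ->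
  {in R & W, forall x y, adj x y -> y \in X} ->
  divisible R -> divisible W -> divisible (R :|: W).
Proof.
move=> dRW XW cX cRX RWX [A1 [B1 [eR d1 p1 o1]]] [A2 [B2 [eW d2 p2 o2]]].
have [A1R B1R] : A1 \subset R /\ B1 \subset R by rewrite -eR subsetUl subsetUr.
have [A2W B2W] : A2 \subset W /\ B2 \subset W by rewrite -eW subsetUl subsetUr.
exists (A1 :|: A2), (B1 :|: B2); split.
- by rewrite setUACA eR eW.
- rewrite -!setI_eq0 in d1 d2 dRW *; apply/eqP/setP => x.
  move/eqP/setP/(_ x): d1; move/eqP/setP/(_ x): d2; move/eqP/setP/(_ x): dRW.
  rewrite -eR -eW !inE.
  by case: (x \in A1); case: (x \in B1); case: (x \in A2); case: (x \in B2).
- apply: (perf_glue cX) => // [x y xA|x y xA yA xy].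
    by apply: cRX; apply: (subsetP A1R).
  by apply: RWX xy; [apply: (subsetP A1R) | apply: (subsetP A2W)].
have [K [cK KB <-]] := om_witness (B1 :|: B2).
have [K1|/set0Pn[r]] := eqVneq (K :&: B1) set0.
  apply: leq_ltn_trans (leq_trans o2 (om_sub (subsetUr _ _))).
  apply: om_max => //; apply/subsetP => x xK; have := subsetP KB _ xK.
  rewrite inE; case/orP=> // xB; have : x \in K :&: B1 by rewrite inE xK.
  by rewrite K1 inE.
rewrite inE => /andP[rK rB].
have rR := subsetP B1R _ rB.
have KX x : x \in K -> x \notin B1 -> x \in X.
  move=> xK xB; have := subsetP KB _ xK; rewrite inE (negbTE xB) /= => xB2.
  apply: (RWX r) => //; first exact: (subsetP B2W).
  by move/cliqueP: cK; apply=> //; apply: contraNneq xB => <-.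
rewrite -(cardsID B1 K).
have cKX : clique (K :\: B1) by apply: clique_sub cK; apply: subsetDl.
apply: (@leq_trans (om R + #|K :\: B1|)).
  rewrite ltn_add2r; apply: leq_ltn_trans o1; apply: om_max; last exact: subsetIr.
  by apply: clique_sub cK; apply: subsetIl.
have KDX : K :\: B1 \subset X.
  by apply/subsetP => x; rewrite inE => /andP[xB xK]; apply: KX.
apply: leq_trans (om_join cKX _) (om_sub _).
  by move=> x y xR /(subsetP KDX); apply: cRX.
by apply: setUS; apply: subset_trans XW.
Qed.

Lemma min_imperf_nonneighbors S x : ~~ perf (S :\: nbhd x) ->
  exists F, [/\ min_imperf F, F \subset S, x \notin F & {in F, forall f, ~~ adj x f}].
Proof.
move=> /min_imperf_exists[F mF FS].
have FP f : f \in F -> f \in S /\ ~~ adj x f.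
  by move/(subsetP FS); rewrite !inE => /andP[].
exists F; split=> // [|| f /FP[] //]; first by apply/subsetP => f /FP[].
(* In [F] the vertex [x] would be isolated, so [[set x]] could be split off along the empty
   clique. *)
apply/negP => xF.
apply: (min_imperf_noglue mF (D := [set x]) _ _ _ (clique0 G)).
- by rewrite sub1set.
- by apply/set0Pn; exists x; rewrite inE.
- apply/eqP => e; have [/negP[]] := min_imperfP mF; rewrite -e; apply: perf_clique.
  by apply/cliqueP => a b /set1P-> /set1P->; rewrite eqxx.
- by move=> a b _; rewrite inE.
- by move=> a b /set1P-> /FP[_ /negbTE->].
Qed.

Lemma divisible_all S : S != set0 -> divisible S.
Proof.
have [n] := ubnP #|S|; elim: n S => // n IH S; rewrite ltnS => Sn S0.
have [/exists_inP[v vS]|/exists_inPn/= imp] := boolP [exists v in S, perf (S :\: nbhd v)].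
  exact: divisible_nonneighbors.
pose good (p : {set G} * {set G}) :=
  [&& separated p.1 p.2, p.1 \subset S & p.2 \subset S].
(* A single vertex serves as [Z], with a minimal imperfect set among its non-neighbours. *)
have [p0 good0] : exists p, good p.
  have [v vS] := set0Pn _ S0; have [F [mF FS vF nF]] := min_imperf_nonneighbors (imp v vS).
  exists (F, [set v]); rewrite /good FS sub1set vS /separated mF conn1 !andbT /=.
  apply/and3P; split; first by apply/set0Pn; exists v; rewrite inE.
    by rewrite disjoints1.
  by apply/anticompleteP => z f /set1P->; apply: nF.
case: (arg_maxnP (fun p : {set G} * {set G} => #|p.2|) good0) => -[F Z] /=.
case/and3P=> /= sFZ FS ZS maxZ.
have [mF cZ Z0 dZF /anticompleteP aZF] := and5P sFZ.
(* A connected set larger than [Z] is anticomplete to no minimal imperfect set. *)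
have max_attach F' x : min_imperf F' -> F' \subset S -> x \in S -> x \notin Z ->
    (exists2 z, z \in Z & adj x z) -> [disjoint x |: Z & F'] ->
    {in Z & F', forall z f, ~~ adj z f} -> {in F', forall f, ~~ adj x f} -> False.
  move=> mF' F'S xS xZ [z zZ xz] dF' aF' nF'.
  have := maxZ (F', x |: Z); rewrite cardsU1 xZ ltnn => h; apply: notF; apply: h.
  rewrite /good /= F'S subUset sub1set xS ZS !andbT /separated mF' dF'.
  rewrite (conn_add cZ zZ xz) /=; apply/andP; split.
    by apply/set0Pn; exists x; rewrite !inE eqxx.
  by apply/anticompleteP => y f; rewrite !inE => /orP[/eqP->|yZ] fF; auto.
pose X := [set x in S :\: Z | [exists z in Z, adj x z]].
have XP x : x \in X -> [/\ x \in S, x \notin Z & exists2 z, z \in Z & adj x z].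
  by rewrite !inE => /andP[/andP[xZ xS]] /exists_inP.
have XF x : x \in X -> exists2 f, f \in F & adj x f.
  move=> /XP[xS xZ xz].
  have [/exists_inP//|/exists_inPn nF] := boolP [exists f in F, adj x f]; exfalso.
  apply: (max_attach F x) => //.
  rewrite -setI_eq0 setIUl setU_eq0 !setI_eq0 disjoints1 dZF andbT.
  apply/negP => xF; have [z zZ] := xz.
  by rewrite adj_sym (negbTE (aZF _ _ zZ xF)).
have cX : clique X.
  apply/cliqueP => x y xX yX xy.
  have [_ _ hx] := XP _ xX; have [_ _ hy] := XP _ yX.
  by apply: (attachments_adj sFZ xy) => //; apply: XF.
have Xmixed x : x \in X -> exists2 z, z \in Z & ~~ adj x z.
  move=> xX; have [xS xZ xz] := XP _ xX.
  have [F' [mF' F'S xF' nF']] := min_imperf_nonneighbors (imp x xS).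
  have [dZ|/pred0Pn[z /andP[zZ zF']]] := boolP [disjoint Z & F']; last first.
    by exists z => //; apply: nF'.
  exfalso; apply: (max_attach F' x) => //.
    by rewrite -setI_eq0 setIUl setU_eq0 !setI_eq0 disjoints1 xF'.
  (* A vertex [f] of [F'] with a neighbour in [Z] would lie in the clique [X] and so be adjacent to
     [x]. *)
  move=> z f zZ fF'; apply/negP => zf.
  have fX : f \in X.
    rewrite !inE (subsetP F'S _ fF') andbT; apply/andP; split.
      by rewrite (disjointFl dZ).
    by apply/exists_inP; exists z; rewrite // adj_sym.
  have xf : x != f by apply: contraNneq xF' => ->.
  by have := nF' _ fF'; rewrite (cliqueP _ cX _ _ xX fX xf).
have [|R [cR FR RS Rcl]] := @component_exists F (S :\: (Z :|: X)) (min_imperf_conn mF).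
  apply/subsetP => f fF; rewrite !inE (subsetP FS) // andbT.
  rewrite (disjointFl dZF) //=; apply/negP => /exists_inP[z zZ].
  by rewrite adj_sym (negbTE (aZF _ _ zZ fF)).
have RP r : r \in R -> [/\ r \in S, r \notin Z & r \notin X].
  by move/(subsetP RS); rewrite in_setD in_setU negb_or -andbA => /and3P[].
have aRZ r z : r \in R -> z \in Z -> ~~ adj r z.
  move=> /RP[rS rZ rX] zZ; apply: contra rX => rz; rewrite !inE rZ rS /=.
  by apply/exists_inP; exists z.
(* A vertex [x] mixed on both [R] and [Z] would be the middle of a P5 with an edge of [R] and an
   edge of [Z] as its ends. *)
have XcR : complete R X.
  move=> r x rR xX; apply/idPn; rewrite adj_sym => xr.
  have [_ _ hx] := XP _ xX.
  have [f fF xf] := XF _ xX.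
  have [||a [b [aR bR xa xb ab]]] := @conn_mixed R x cR.
  - by exists f => //; apply: (subsetP FR).
  - by exists r.
  have [z [z' [zZ z'Z xz xz' zz']]] := conn_mixed cZ hx (Xmixed _ xX).
  by apply: (@P5_free b a x z z') => //; first [by apply: aRZ | by rewrite adj_sym].
have R0 : R != set0.
  by apply: contraNneq (min_imperf_neq0 mF) => R0; rewrite -subset0 -R0.
have [z zZ] := set0Pn _ Z0.
have zR : z \in S :\: R.
  by rewrite inE (subsetP ZS) // andbT; apply: contraL zZ => /RP[].
have RSub : R \subset S by apply/subsetP => r /RP[].
have -> : S = R :|: (S :\: R) by rewrite -{1}(setID S R) (setIidPr RSub).
have cardS := cardsID R S; rewrite (setIidPr RSub) in cardS.
apply: (@divisible_glue _ _ X) => //.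
- by rewrite -setI_eq0 setIDA setD_eq0 subsetIl.
- apply/subsetP => x xX; have [xS _ _] := XP _ xX; rewrite inE xS andbT.
  by apply: contraL xX => /RP[].
(* A neighbour of [R] outside [X] is not in [Z] either, so it belongs to the component [R]. *)
- move=> r y rR; rewrite inE => /andP[yR yS] ry; apply: contraNT yR => yX.
  apply: (Rcl r) => //; rewrite in_setD in_setU negb_or yS yX !andbT.
  by apply: contraTN ry; apply: aRZ.
(* [R] is smaller than [S] because it misses [z], and [S :\: R] is smaller because [R] is
   nonempty. *)
- apply: IH => //; apply: leq_trans Sn; rewrite -cardS -addn1 leq_add2l.
  by apply/card_gt0P; exists z.
- apply: IH; last by apply/set0Pn; exists z.
  by apply: leq_trans Sn; rewrite -cardS -add1n leq_add2r card_gt0.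
Qed.

End Free.
End Perfect.

(** * Forbidden subgraphs from explicit vertices, and the theorem *)

Lemma contains_P5 (G : sgraph) (a b c d e : G) :
  adj a b -> adj b c -> adj c d -> adj d e ->
  ~~ adj a c -> ~~ adj a d -> ~~ adj a e -> ~~ adj b d -> ~~ adj b e -> ~~ adj c e ->
  contains_induced G (path_graph 5).
Proof.
move=> ab bc cd de ac ad ae bd be ce.
pose f (i : path_graph 5) := nth a [:: a; b; c; d; e] (val i).
have fA x y : adj (f x) (f y) = adj x y.
  case: x y => [[|[|[|[|[|//]]]]] ?] [[|[|[|[|[|//]]]]] ?];
  rewrite /f /= ?adj_irrefl // ?[adj b a]adj_sym ?[adj c a]adj_sym ?[adj d a]adj_sym
    ?[adj e a]adj_sym ?[adj c b]adj_sym ?[adj d b]adj_sym ?[adj e b]adj_sym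
    ?[adj d c]adj_sym ?[adj e c]adj_sym ?[adj e d]adj_sym //; exact/negbTE.
(* Distinct vertices of P5 have distinct neighbourhoods, so [fA] already forces injectivity; the
   same holds for C5. *)
exists f => // x y fxy.
have h z : adj x z = adj y z by rewrite -!fA fxy.
have {}h k (k5 : k < 5) := h (Ordinal k5).
apply/val_inj; move: (h 0 isT) (h 1 isT) (h 2 isT) (h 3 isT) (h 4 isT).
by case: x y {h fxy} => [[|[|[|[|[|//]]]]] ?] [[|[|[|[|[|//]]]]] ?].
Qed.

Lemma contains_C5 (G : sgraph) (a b c d e : G) :
  adj a b -> adj b c -> adj c d -> adj d e -> adj e a ->
  ~~ adj a c -> ~~ adj a d -> ~~ adj b d -> ~~ adj b e -> ~~ adj c e ->
  contains_induced G (cycle_graph 5).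
Proof.
move=> ab bc cd de ea ac ad bd be ce.
pose f (i : cycle_graph 5) := nth a [:: a; b; c; d; e] (val i).
have fA x y : adj (f x) (f y) = adj x y.
  case: x y => [[|[|[|[|[|//]]]]] ?] [[|[|[|[|[|//]]]]] ?];
  rewrite /f /= ?adj_irrefl // ?[adj b a]adj_sym ?[adj c a]adj_sym ?[adj d a]adj_sym
    ?[adj a e]adj_sym ?[adj c b]adj_sym ?[adj d b]adj_sym ?[adj e b]adj_sym
    ?[adj d c]adj_sym ?[adj e c]adj_sym ?[adj e d]adj_sym //; exact/negbTE.
exists f => // x y fxy.
have h z : adj x z = adj y z by rewrite -!fA fxy.
have {}h k (k5 : k < 5) := h (Ordinal k5).
apply/val_inj; move: (h 0 isT) (h 1 isT) (h 2 isT) (h 3 isT) (h 4 isT).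
by case: x y {h fxy} => [[|[|[|[|[|//]]]]] ?] [[|[|[|[|[|//]]]]] ?].
Qed.

Lemma contains_K23 (G : sgraph) (a b x y z : G) :
  a != b -> ~~ adj a b -> x != y -> x != z -> y != z ->
  ~~ adj x y -> ~~ adj x z -> ~~ adj y z ->
  adj a x -> adj a y -> adj a z -> adj b x -> adj b y -> adj b z ->
  contains_induced G (complete_bipartite 2 3).
Proof.
move=> ab nab xy xz yz nxy nxz nyz ax ay az bx by_ bz.
pose f (i : complete_bipartite 2 3) :=
  match i with inl i => nth a [:: a; b] i | inr i => nth a [:: x; y; z] i end.
have fA u v : adj (f u) (f v) = adj u v.
  case: u v => [[[|[|//]] ?]|[[|[|[|//]]] ?]] [[[|[|//]] ?]|[[|[|[|//]]] ?]];
  rewrite /f /= ?adj_irrefl // ?[adj b a]adj_sym ?[adj y x]adj_sym ?[adj z x]adj_sym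
    ?[adj z y]adj_sym ?[adj x a]adj_sym ?[adj y a]adj_sym ?[adj z a]adj_sym
    ?[adj x b]adj_sym ?[adj y b]adj_sym ?[adj z b]adj_sym //; exact/negbTE.
exists f => // u v fuv.
have h w : adj u w = adj v w by rewrite -!fA fuv.
(* Vertices on one side of K_{2,3} are twins, so there injectivity comes from the assumed
   inequalities. *)
case: u v fuv h => [[[|[|//]] i]|[[|[|[|//]]] i]] [[[|[|//]] j]|[[|[|[|//]]] j]];
  rewrite /f /= => fuv h; try (by move: (h (inl ord0)));
  try (congr (_ _); exact: val_inj);
  by move: ab xy xz yz; rewrite ?fuv ?eqxx.
Qed.

Theorem theorem1p1 (G : sgraph) :
  connected_graph G ->
  ~ contains_induced G (path_graph 5) ->
  ~ contains_induced G (cycle_graph 5) ->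
  ~ contains_induced G (complete_bipartite 2 3) ->
  perfectly_divisible G.
Proof.
move=> _ noP5 noC5 noK23 S S0.
have [|||A [B [eAB dAB pA oB]]] := @divisible_all G _ _ _ S S0.
- by move=> a b c d e *; apply: noP5; apply: (@contains_P5 G a b c d e).
- by move=> a b c d e *; apply: noC5; apply: (@contains_C5 G a b c d e).
- by move=> a b x y z *; apply: noK23; apply: (@contains_K23 G a b x y z).
pose pre (C : {set G}) : {set induced S} := [set x | val x \in C].
exists (pre A), (pre B); split.
- by apply/setP => x; rewrite !inE -in_setU eAB; apply: (valP x).
- rewrite -setI_eq0; apply/eqP/setP => x; rewrite !inE; apply/negP => /andP[xA].
  by rewrite (disjointFr dAB xA).
(* Vertices of [induced T] are nested three subtypes deep, through [pre A] and [S]; the composite of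
   the three [val] embeds them in [G], with image inside [A]. *)
- move=> T; apply/(@chi_omega_imset G (induced T) (fun x => val (val (val x)))).
  + by move=> x y /val_inj/val_inj/val_inj.
  + by [].
  move/perfP: pA; apply; apply/subsetP => _ /imsetP[x _ ->].
  by have := valP (val x); rewrite inE.
have vS : omega (induced S) = om S.
  by rewrite (@omega_imset G (induced S) val val_inj (fun _ _ => erefl)) val_imsetT.
rewrite vS; apply: leq_ltn_trans oB.
rewrite (@omega_imset G (induced (pre B)) (fun x => val (val x))) //.
  apply: om_sub; apply/subsetP => _ /imsetP[x _ ->].
  by have := valP x; rewrite inE.
by move=> x y /val_inj/val_inj.
Qed.
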